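(* Suppose there is a constant $\delta\ge 0$ such that $W_p(\mathbb{P}_i,\mathbb{P}_j)\le\delta$ for all $i,j\in[n]$. Let $p\ge 1$, and for each $i\in[n]$ let $N_i\ge 1$, $\beta_i\in(0,1)$ and $\varepsilon_i:=\varepsilon_i^{N_i}(\beta_i)$, where $\varepsilon_i^{N_i}(\cdot)$ is the radius function defined in the context. For each $i$ define $\bar\beta_i\in(0,1]$ as follows: if $\varepsilon_i>\delta$, let $\bar\beta_i\in(0,1)$ be defined by $$\varepsilon_i^{N_i}(\bar\beta_i)=\varepsilon_i-\delta;$$ if this equation has no solution in $(0,1)$, or if $\varepsilon_i\le\delta$, set $\bar\beta_i=1$. Then the global ambiguity set $\mathcal{W}_{\mathrm G}$ satisfies $$\Pr\{\mathbb{P}\in\mathcal{W}_{\mathrm G}\}\ \ge\ 1-\beta,\qquad 1-\beta:=\max\Big\{\prod_{i=1}^n(1-\beta_i),\ 1-\prod_{i=1}^n\bar\beta_i\Big\},$$ where the probability is with respect to the joint sampling of the client datasets.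
   Context: Let $[n]=\{1,\dots,n\}$, let $\Xi\subseteq\mathbb{R}^m$ be convex and compact, and let $p\in[1,\infty)$. $\mathcal{M}(\Xi)$ is the set of probability distributions supported on $\Xi$ (with finite $p$-th moment). $W_p$ is the $p$-Wasserstein distance for the Euclidean metric: $W_p(\mathbb{Q},\mathbb{Q}')=\big(\inf_{\gamma\in\Gamma(\mathbb{Q},\mathbb{Q}')}\int\|x-y\|^p\,d\gamma(x,y)\big)^{1/p}$, where $\Gamma(\mathbb{Q},\mathbb{Q}')$ is the set of couplings. Each client $i\in[n]$ has an (unknown) distribution $\mathbb{P}_i\in\mathcal{M}(\Xi)$. Its dataset $\mathcal{D}_i=\{\widehat\xi_i^1,\dots,\widehat\xi_i^{N_i}\}$ consists of $N_i$ i.i.d. samples from $\mathbb{P}_i$, and the datasets $\mathcal{D}_1,\dots,\mathcal{D}_n$ are mutually independent. The empirical distribution is $\widehat{\mathbb{P}}_i=\frac1{N_i}\sum_{k=1}^{N_i}\delta_{\widehat\xi_i^k}$. The true group distribution is $\mathbb{P}=\sum_{i=1}^n\alpha_i^\star\mathbb{P}_i$ for some unknown $\alpha^\star\in\Delta_{n-1}:=\{\alpha\in\mathbb{R}^n:\alpha_i\ge0,\ \sum_i\alpha_i=1\}$. Local ambiguity sets: $\mathcal{W}_i(\varepsilon_i)=\{\mathbb{Q}\in\mathcal{M}(\Xi): W_p(\mathbb{Q},\widehat{\mathbb{P}}_i)\le\varepsilon_i\}$. Global ambiguity set: $\mathcal{W}_{\mathrm G}=\{\sum_{i=1}^n\alpha_i\mathbb{Q}_i:\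 \alpha\in\Delta_{n-1},\ \mathbb{Q}_i\in\mathcal{W}_i(\varepsilon_i)\ \forall i\}$. Radius function: with $R:=\frac12\mathrm{diam}_\infty(\Xi)$ (half the diameter of $\Xi$ in the infinity norm) and $h(x):=x^2/(\ln(2+1/x))^2$ for $x>0$, define for $\beta\in(0,1)$ $$\varepsilon_i^{N_i}(\beta):=\begin{cases}R\Big[h^{-1}\Big(\frac{\ln(c_1\beta^{-1})}{c_2N_i}\Big)\Big]^{1/p},& p=m/2,\\ R\Big(\frac{\ln(c_1\beta^{-1})}{c_2N_i}\Big)^{1/\max\{2p,m\}},& p\ne m/2.\end{cases}$$ Here $c_1,c_2$ are constants depending only on $p$ and $m$, namely the constants of the known measure-concentration result (which may be taken as given): these radii are well defined for all $\beta\in(0,1)$, and for every client $i$, every $N_i\ge1$ and every $\beta\in(0,1)$, $\Pr\{W_p(\mathbb{P}_i,\widehat{\mathbb{P}}_i)\le\varepsilon_i^{N_i}(\beta)\}\ge1-\beta$. *)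

(* Defs.v *)
From HB Require Import structures.
From mathcomp Require Import all_boot all_order all_algebra.
From mathcomp Require Import all_classical all_reals all_analysis.

Set Implicit Arguments.
Unset Strict Implicit.
Unset Printing Implicit Defensive.
Import Order.TTheory GRing.Theory Num.Theory.
Import numFieldNormedType.Exports.

Local Open Scope classical_set_scope.
Local Open Scope ring_scope.

(* R^m with its Borel sigma-algebra; the carrier is convertible to 'rV[R]_m. *)
Notation borel_rV R m := (g_sigma_algebraType (@open 'rV[R]_m)).

Section geometry.
Context {R : realType} {m : nat}.

Definition enorm (x : 'rV[R]_m) : R := Num.sqrt (\sum_(i < m) x ord0 i ^+ 2).

(* The norm `|x| of the library on 'rV[R]_m is the sup norm. *)
Definition half_diam_inf (Xi : set 'rV[R]_m) : R :=
  sup [set `|z.1 - z.2| | z in Xi `*` Xi] / 2.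

End geometry.

Section wasserstein.
Context {R : realType} {m : nat}.
Local Notation E := (borel_rV R m).

Definition coupling (mu nu : set E -> \bar R) : set (probability (E * E)%type R) :=
  [set gam : probability (E * E)%type R | forall A : set E, measurable A ->
     gam (fst @^-1` A) = mu A /\ gam (snd @^-1` A) = nu A].

Definition wasserstein (p : R) (mu nu : set E -> \bar R) : \bar R :=
  poweR (ereal_inf [set (\int[gam]_z (enorm (z.1 - z.2 : 'rV[R]_m) `^ p)%:E)%E
                   | gam in coupling mu nu]) p^-1.

(* [Xi] is meant to be closed: [mu Xi = 1] then says that the support of [mu]
   is contained in [Xi]. *)
Definition distributions (p : R) (Xi : set 'rV[R]_m) : set (probability E R) :=
  [set mu : probability E R | mu Xi = 1%E /\ (\int[mu]_x (enorm (x : 'rV[R]_m) `^ p)%:E < +oo)%E].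

Definition simplex (n : nat) : set ('I_n -> R) :=
  [set a | (forall i, 0 <= a i) /\ \sum_(i < n) a i = 1].

Definition is_mixture (n : nat) (a : 'I_n -> R)
    (Q : 'I_n -> probability E R) (mu : probability E R) : Prop :=
  forall A : set E, measurable A -> (mu A = \sum_(i < n) (a i)%:E * Q i A)%E.

Definition local_ambiguity (p : R) (Xi : set 'rV[R]_m) (nu : set E -> \bar R)
    (eps : R) : set (probability E R) :=
  [set Q : probability E R | distributions p Xi Q /\ (wasserstein p Q nu <= eps%:E)%E].

Definition global_ambiguity (p : R) (Xi : set 'rV[R]_m) (n : nat)
    (nu : 'I_n -> set E -> \bar R) (eps : 'I_n -> R) : set (probability E R) :=
  [set mu : probability E R | exists a : 'I_n -> R, exists Q : 'I_n -> probability E R,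
     [/\ simplex a,
         forall i, local_ambiguity p Xi (nu i) (eps i) (Q i)
       & is_mixture a Q mu]].

End wasserstein.

Section empirical.
Context {R : realType} {m N : nat}.
Local Notation E := (borel_rV R m).
Variable x : 'I_N -> E.

Definition empirical (A : set E) : \bar R :=
  ((N%:R^-1)%:E * \sum_(k < N) \d_(x k) A)%E.

Let empirical0 : empirical set0 = 0%E.
Proof.
by rewrite /empirical big1 ?mule0// => k _; rewrite measure0.
Qed.

Let empirical_ge0 A : (0 <= empirical A)%E.
Proof.
by rewrite mule_ge0// ?lee_fin ?invr_ge0//; apply: sume_ge0 => k _.
Qed.

Let empirical_sigma_additive : semi_sigma_additive empirical.
Proof.
move=> F mF tF mUF.
rewrite [X in X @ _ --> _](_ : _ = (fun n => (N%:R^-1)%:E *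
    \sum_(k < N) \sum_(0 <= i < n) \d_(x k) (F i))%E); last first.
  apply/funext => n; rewrite exchange_big/= ge0_sume_distrr// => i _.
  exact: sume_ge0.
apply: cvgeZl => //.
apply: cvg_nnesum => [k _|k _].
  by near=> n; apply: sume_ge0.
exact: measure_semi_sigma_additive.
Unshelve. all: by end_near. Qed.

HB.instance Definition _ := isMeasure.Build _ E R empirical
  empirical0 empirical_ge0 empirical_sigma_additive.

End empirical.

Section sampling.
Context {R : realType} {d : measure_display} {Om : measurableType d}.
Variable Pr : probability Om R.

Definition mutually_independent (I : finType) (F : I -> set (set Om)) : Prop :=
  forall (J : {set I}) (A : I -> set Om), (forall i, i \in J -> F i (A i)) ->
    Pr (\bigcap_(i in [set` J]) A i) = (\prod_(i in J) Pr (A i))%E.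

Definition iid_sample (m N : nat) (mu : probability (borel_rV R m) R)
    (X : 'I_N -> {RV Pr >-> borel_rV R m}) : Prop :=
  mutually_independent (fun k => preimage_set_system setT (X k) measurable) /\
  forall k (A : set (borel_rV R m)), measurable A -> distribution Pr (X k) A = mu A.

Definition independent_samples (m n : nat) (N : 'I_n -> nat)
    (X : forall i, 'I_(N i) -> {RV Pr >-> borel_rV R m}) : Prop :=
  mutually_independent
    (fun i => g_sigma_preimage (fun k : 'I_(N i) => (X i k : Om -> borel_rV R m))).

(* Probability of an event whose measurability is not known a priori: the
   supremum of the probabilities of the measurable events it contains (the
   largest meaningful lower bound for its probability). A probability of the
   library carries no information on non-measurable sets. *)
Definition inner_prob (A : set Om) : \bar R :=
  ereal_sup [set Pr B | B in [set B | measurable B /\ B `<=` A]].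

Lemma inner_prob_measurable (A : set Om) : measurable A -> inner_prob A = Pr A.
Proof.
move=> mA; apply/eqP; rewrite eq_le; apply/andP; split.
  by apply: ge_ereal_sup => _ [B [mB BA] <-]; apply: le_measure; rewrite ?inE.
by apply: ereal_sup_ubound; exists A => /=; split.
Qed.

End sampling.

Section conc_radius.
Context {R : realType}.

Definition conc_rate (x : R) : R := x ^+ 2 / (ln (2 + 1 / x)) ^+ 2.

(* [conc_rate] is an increasing bijection of ]0, +oo[ onto itself. *)
Definition conc_rate_inv : R -> R := pinv [set x : R | 0 < x] conc_rate.

Definition conc_radius (m : nat) (p c1 c2 : R) (Xi : set 'rV[R]_m) (N : nat)
    (b : R) : R :=
  let t := ln (c1 * b^-1) / (c2 * N%:R) in
  if p == m%:R / 2 then half_diam_inf Xi * conc_rate_inv t `^ p^-1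
  else half_diam_inf Xi * t `^ (Num.max (2 * p) m%:R)^-1.

(* The measure-concentration property of the constants, which depend on [p] and
   [m] only. [1 <= c1] and [0 < c2] say that the radii are well defined for all
   confidence levels: ln (c1 / b) / (c2 * N) > 0 for every b in ]0, 1[. *)
Definition concentration_constants (m : nat) (p c1 c2 : R) : Prop :=
  [/\ 1 <= c1, 0 < c2 &
   forall (Xi : set 'rV[R]_m) (mu : probability (borel_rV R m) R)
     (d : measure_display) (Om : measurableType d) (Pr : probability Om R)
     (N : nat) (X : 'I_N -> {RV Pr >-> borel_rV R m}) (b : R),
     convex_set Xi -> compact Xi -> distributions p Xi mu ->
     (0 < N)%N -> iid_sample mu X -> 0 < b < 1 ->
     ((1 - b)%:E <= Pr [set w | (wasserstein p mu (empirical (fun k => X k w))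
                                  <= (conc_radius p c1 c2 Xi N b)%:E)%E])%E].

(* [bb] is the level b at which the radius function [eps_fun] equals
   [eps - delta] if [delta < eps] and there is such a b in ]0, 1[; else 1. *)
Definition shifted_level (eps_fun : R -> R) (eps delta bb : R) : Prop :=
  let solution (b : R) : Prop := 0 < b < 1 /\ eps_fun b = eps - delta in
  (delta < eps /\ solution bb) \/
  ((eps <= delta \/ ~ exists b, solution b) /\ bb = 1).

End conc_radius.

(* Main.v *)
(* On the event that every client's distribution lies in its ball, the true
   mixture is itself a witness; independence gives the first bound.  For the
   second one it suffices that one client i satisfies
   W(P_i, emp_i) <= eps_i - delta: then W(P_j, emp_i) <= eps_i for every j by the
   triangle inequality, hence W(P, emp_i) <= eps_i by convexity, and the weight
   vector can be concentrated on i.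

   Only the case of an empirical second argument is needed in the triangle
   inequality.  A coupling of P with an empirical measure is turned, by
   Radon-Nikodym, into weights f_k(x), the conditional probabilities of sending x
   to the k-th sample point; composing the weights with another coupling glues the
   two plans.  The same transport argument shows that W(P, emp) is 1-Lipschitz in
   the sample points, so its sublevel sets are countable combinations of events
   that each involve one sample point, which makes them measurable for the
   sigma-algebra of the client's own data, as independence requires. *)
Require Import Defs.
From HB Require Import structures.
From mathcomp Require Import all_boot all_order all_algebra.
From mathcomp Require Import all_classical all_reals all_analysis measurable_realfun.
From mathcomp Require Import ring lra.
Import Order.TTheory GRing.Theory Num.Theory.
Import numFieldNormedType.Exports.
Local Open Scope classical_set_scope.
Local Open Scope ring_scope.
Set Implicit Arguments.
Unset Strict Implicit.
Unset Printing Implicit Defensive.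

(** * The Euclidean norm *)

Section enorm.
Context {R : realType} {m : nat}.
Implicit Types x y z : 'rV[R]_m.
Local Notation E := (borel_rV R m).

Lemma enorm_ge0 x : 0 <= enorm x.
Proof. exact: sqrtr_ge0. Qed.

Lemma enorm0 : enorm (0 : 'rV[R]_m) = 0.
Proof. by rewrite /enorm big1 ?sqrtr0// => i _; rewrite mxE expr0n. Qed.

Lemma enormN x : enorm (- x) = enorm x.
Proof. by congr Num.sqrt; apply: eq_bigr => i _; rewrite mxE sqrrN. Qed.

Lemma sqr_enorm x : enorm x ^+ 2 = \sum_(i < m) x ord0 i ^+ 2.
Proof. by rewrite sqr_sqrtr// sumr_ge0// => i _; rewrite sqr_ge0. Qed.

Lemma enorm_eq0 x : enorm x = 0 -> x = 0.
Proof.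
move=> x0; have := sqr_enorm x; rewrite x0 expr0n/= => /esym/eqP.
rewrite psumr_eq0; last by move=> i _; rewrite sqr_ge0.
move=> /allP h; apply/rowP => i; rewrite mxE; apply/eqP.
by have := h i (mem_index_enum _); rewrite sqrf_eq0.
Qed.

(** Outside the degenerate cases, the sum of the squares of [x_i * |y| - y_i * |x|] is nonnegative
    and equals [2 * |x| * |y| * (|x| * |y| - <x, y>)]. *)
Lemma enorm_cauchy_schwarz x y :
  \sum_(i < m) x ord0 i * y ord0 i <= enorm x * enorm y.
Proof.
have [x0|x0] := eqVneq (enorm x) 0.
  by rewrite x0 mul0r big1// => i _; rewrite (enorm_eq0 x0) mxE mul0r.
have [y0|y0] := eqVneq (enorm y) 0.
  by rewrite y0 mulr0 big1// => i _; rewrite (enorm_eq0 y0) mxE mulr0.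
have xy0 : 0 < enorm x * enorm y.
  by rewrite mulr_gt0// lt0r ?x0 ?y0 enorm_ge0.
have : 0 <= \sum_(i < m) (x ord0 i * enorm y - y ord0 i * enorm x) ^+ 2.
  by rewrite sumr_ge0// => i _; rewrite sqr_ge0.
have -> : \sum_(i < m) (x ord0 i * enorm y - y ord0 i * enorm x) ^+ 2 =
  enorm x ^+ 2 * enorm y ^+ 2 + enorm y ^+ 2 * enorm x ^+ 2
   - \sum_(i < m) x ord0 i * y ord0 i * (2 * (enorm x * enorm y)).
  rewrite [X in X * _ + _]sqr_enorm [X in _ + X * _ - _]sqr_enorm.
  rewrite !mulr_suml -big_split -sumrB/=.
  by apply: eq_bigr => i _; ring.
rewrite -mulr_suml => h.
rewrite -(ler_pM2r xy0); nra.
Qed.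

Lemma enormD x y : enorm (x + y) <= enorm x + enorm y.
Proof.
rewrite -(@ler_pXn2r _ 2)// ?nnegrE ?addr_ge0 ?enorm_ge0//.
rewrite sqr_enorm sqrrD !sqr_enorm.
under eq_bigr do rewrite mxE sqrrD.
rewrite !big_split/= lerD2r lerD2l -mulr2n ler_pMn2r//.
exact: enorm_cauchy_schwarz.
Qed.

Lemma enormB_triangle x y z : enorm (x - z) <= enorm (x - y) + enorm (y - z).
Proof. by rewrite -[x - z](subrKA y) enormD. Qed.

Lemma measurable_coord (i : 'I_m) :
  measurable_fun setT (fun x : E => (x : 'rV[R]_m) ord0 i).
Proof.
apply: (measurability _ (RGenOpens.measurableE R)).
move=> _ [_ [a [b ->]] <-]; rewrite setTI; apply: sub_sigma_algebra.
by apply: open_comp => [x _|]; [exact: coord_continuous|exact: interval_open].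
Qed.

Lemma measurable_enormB d (T : measurableType d) (f g : T -> E) :
  measurable_fun setT f -> measurable_fun setT g ->
  measurable_fun setT (fun t => enorm ((f t : 'rV[R]_m) - g t)).
Proof.
move=> mf mg; rewrite /enorm.
apply: (@measurableT_comp _ _ _ _ _ _ (@Num.sqrt R)).
  by apply: continuous_measurable_fun; exact: sqrt_continuous.
apply: measurable_sum => i; under eq_fun do rewrite !mxE.
apply: measurable_funX; apply: measurable_funB.
  exact: measurableT_comp (measurable_coord i) mf.
exact: measurableT_comp (measurable_coord i) mg.
Qed.
End enorm.

(** * Convexity of powers *)

Section powR.
Context {R : realType}.

(* Convexity of [`^ p] applied to the barycenter
   (a + b) / (s + t) = s / (s + t) * (a / s) + t / (s + t) * (b / t);
   integrated, it replaces Minkowski's inequality. *)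
Lemma powRD_le_combination (p s t : R) : 1 <= p -> 0 < s -> 0 < t ->
  exists c1 c2 : R, [/\ 0 <= c1, 0 <= c2,
    c1 * s `^ p + c2 * t `^ p = (s + t) `^ p &
    forall a b, 0 <= a -> 0 <= b -> (a + b) `^ p <= c1 * a `^ p + c2 * b `^ p].
Proof.
move=> p1 s0 t0.
have st0 : 0 < s + t by rewrite addr_gt0.
pose l := s / (s + t).
have l0 : 0 <= l by rewrite divr_ge0// ltW.
have l1 : l <= 1 by rewrite ler_pdivrMr// mul1r lerDl ltW.
have lE : 1 - l = t / (s + t) by rewrite /l; field; rewrite gt_eqF.
exists ((s + t) `^ p * l / s `^ p), ((s + t) `^ p * (1 - l) / t `^ p).
have sp0 : s `^ p != 0 by rewrite gt_eqF// powR_gt0.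
have tp0 : t `^ p != 0 by rewrite gt_eqF// powR_gt0.
split.
- by rewrite divr_ge0 ?powR_ge0// mulr_ge0 ?powR_ge0//.
- by rewrite divr_ge0 ?powR_ge0// mulr_ge0 ?powR_ge0// subr_ge0.
- by rewrite !divfK// -mulrDr subrKC mulr1.
- move=> a b a0 b0.
  have as0 : 0 <= a / s by rewrite divr_ge0// ltW.
  have bt0 : 0 <= b / t by rewrite divr_ge0// ltW.
  have -> : a + b = (s + t) * (l * (a / s) + (1 - l) * (b / t)).
    by rewrite lE /l; field; rewrite !gt_eqF.
  rewrite powRM ?(ltW st0)//; last first.
    by rewrite addr_ge0// mulr_ge0// subr_ge0.
  have := @convex_powR R p p1 (Itv01 l0 l1) (a / s) (b / t).
  rewrite !inE/= !in_itv/= !andbT => /(_ as0 bt0).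
  rewrite [X in X `^ _ <= _]convRE [X in _ <= X]convRE/= /unstable.onem => h.
  have -> : a `^ p = (a / s) `^ p * s `^ p.
    by rewrite -powRM// ?ltW// divfK// gt_eqF.
  have -> : b `^ p = (b / t) `^ p * t `^ p.
    by rewrite -powRM// ?ltW// divfK// gt_eqF.
  rewrite [X in _ <= X](_ : _ =
    (s + t) `^ p * (l * (a / s) `^ p + (1 - l) * (b / t) `^ p)).
    by rewrite ler_wpM2l ?powR_ge0.
  by field; rewrite sp0 tp0.
Qed.

End powR.

(** * The Wasserstein distance and the costs of couplings *)

Section wasserstein_basics.
Context {R : realType} {m : nat}.
Local Notation E := (borel_rV R m).
Variables (p : R) (p_ge1 : 1 <= p).
Implicit Types mu nu : set E -> \bar R.

Let p_gt0 : 0 < p. Proof. exact: lt_le_trans p_ge1. Qed.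

Lemma wasserstein_le_cost mu nu (t : R) (gam : probability (E * E)%type R) :
  0 <= t -> coupling mu nu gam ->
  (\int[gam]_z (enorm (z.1 - z.2 : 'rV[R]_m) `^ p)%:E <= (t `^ p)%:E)%E ->
  (wasserstein p mu nu <= t%:E)%E.
Proof.
move=> t0 gamC gamt; rewrite /wasserstein.
set I := ereal_inf _.
have I0 : (0 <= I)%E.
  by apply: le_ereal_inf_tmp => _ [g _ <-]; apply: integral_ge0 => z _;
    rewrite lee_fin powR_ge0.
have It : (I <= (t `^ p)%:E)%E.
  by apply: le_trans gamt; apply: ereal_inf_lbound; exists gam.
have -> : t%:E = poweR (t `^ p)%:E p^-1.
  by rewrite poweR_EFin -powRrM divff ?gt_eqF// powRr1.
by apply: gt0_ler_poweR; rewrite ?invr_ge0 ?(ltW p_gt0)// !in_itv/= ?leey ?andbT//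
  lee_fin powR_ge0.
Qed.

(** The infimum defining the distance is not shown to be attained, so a coupling is extracted only
    at a radius [t] strictly above the bound [s]. *)
Lemma wasserstein_cost_lt mu nu (s t : R) :
  (wasserstein p mu nu <= s%:E)%E -> s < t ->
  exists2 gam, coupling mu nu gam &
    (\int[gam]_z (enorm (z.1 - z.2 : 'rV[R]_m) `^ p)%:E <= (t `^ p)%:E)%E.
Proof.
move=> Ws st.
have s0 : 0 <= s by rewrite -lee_fin (le_trans (poweR_ge0 _ _) Ws).
have t0 : 0 <= t by rewrite ltW// (le_lt_trans s0).
move: Ws; rewrite /wasserstein; set I := ereal_inf _ => Ws.
have It : (I < (t `^ p)%:E)%E.
  rewrite ltNge; apply/negP => tI; move: st; rewrite ltNge => /negP; apply.
  rewrite -lee_fin; apply: le_trans Ws.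
  have -> : t%:E = poweR (t `^ p)%:E p^-1.
    by rewrite poweR_EFin -powRrM divff ?gt_eqF// powRr1.
  apply: gt0_ler_poweR => //; rewrite ?invr_ge0 ?(ltW p_gt0)// !in_itv/= ?leey ?andbT//.
    by rewrite lee_fin powR_ge0.
  by rewrite (le_trans _ tI)// lee_fin powR_ge0.
by have [_ [gam gamC <-] /ltW gamt] := ereal_inf_lt It; exists gam.
Qed.

End wasserstein_basics.

(** * Measures with a density *)

Section density.
Local Open Scope ereal_scope.
Context d (T : measurableType d) (R : realType).
Variable mu : {measure set T -> \bar R}.

Import HBNNSimple.

(** Both sides are monotone limits along the simple approximations [h_ n]; for a simple function the
    identity is the hypothesis on [nu], summed over level sets. *)
Lemma ge0_integral_density (nu : {measure set T -> \bar R}) (f : T -> R) (h : T -> \bar R) :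
  measurable_fun setT f -> (forall x, 0 <= f x)%R ->
  (forall A, measurable A -> nu A = \int[mu]_(x in A) (f x)%:E) ->
  measurable_fun setT h -> (forall x, 0 <= h x) ->
  \int[nu]_x h x = \int[mu]_x (h x * (f x)%:E).
Proof.
move=> mf f0 nuE mh h0.
have mfE : measurable_fun setT (EFin \o f) by exact/measurable_EFinP.
pose h_ := nnsfun_approx measurableT mh.
have h_cvg x : (h_ n x)%:E @[n --> \oo] --> h x.
  exact: (@cvg_nnsfun_approx _ _ _ _ measurableT _ mh).
have h_nd x : {homo (fun n => (h_ n x)%:E) : a b / (a <= b)%N >-> a <= b}.
  by move=> a b ab; rewrite lee_fin; exact/lefP/nd_nnsfun_approx.
have step n : \int[nu]_x (h_ n x)%:E = \int[mu]_x ((h_ n x)%:E * (f x)%:E).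
  rewrite integralT_nnsfun sintegralE.
  under [RHS]eq_integral => x _.
    rewrite fimfunE -fsumEFin// ge0_mule_fsuml; last first.
      by move=> r; rewrite EFinM nnfun_muleindic_ge0.
    over.
  rewrite ge0_integral_fsum//; last 2 first.
  - move=> r; apply: emeasurable_funM => //.
    exact/measurable_EFinP/measurable_funM.
  - move=> r x _; apply: mule_ge0; last by rewrite lee_fin.
    by rewrite EFinM nnfun_muleindic_ge0.
  apply: eq_fsbigr => r _.
  rewrite nuE// integral_mkcond.
  (* [h_ n] is nonnegative, so for [r < 0] its level set is empty and both sides vanish. *)
  have [r0|r0] := leP 0%R r.
    rewrite -ge0_integralZl//; last 2 first.
    - exact/(measurable_restrictT _ _).1/measurable_funTS.
    - by move=> x _; apply: erestrict_ge0 => y _; rewrite lee_fin.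
    apply: eq_integral => x _; rewrite /patch indicE.
    by case: ifPn => _; rewrite ?mulr1 ?mulr0 ?mule0 ?mul0e.
  rewrite preimage_nnfun0// erestrict_set0 integral0 mule0 integral0_eq//.
  by move=> x _; rewrite indicE in_set0 mulr0 mul0e.
transitivity (limn (fun n => \int[nu]_x (h_ n x)%:E)).
  rewrite -monotone_convergence//.
  - by apply: eq_integral => x _; apply/esym/cvg_lim.
  - by move=> n; exact/measurable_EFinP.
  - by move=> n x _; rewrite lee_fin.
transitivity (limn (fun n => \int[mu]_x ((h_ n x)%:E * (f x)%:E))).
  by congr (limn _); apply/funext.
rewrite -monotone_convergence//.
- apply: eq_integral => x _; apply/cvg_lim => //.
  exact: cvgeZr (h_cvg x).
- by move=> n; apply: emeasurable_funM => //; exact/measurable_EFinP.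
- by move=> n x _; rewrite mule_ge0 ?lee_fin.
- by move=> x _ a b ab; rewrite lee_wpmul2r ?lee_fin ?f0// -lee_fin h_nd.
Qed.

Variables (f : T -> R) (mf : measurable_fun setT f) (f0 : forall x, (0 <= f x)%R).

Lemma density_measure : exists nu : {measure set T -> \bar R},
  forall A, measurable A -> nu A = \int[mu]_(x in A) (f x)%:E.
Proof.
pose nu A := \int[mu]_(x in A) (f x)%:E.
have nu0 : nu set0 = 0 by exact: integral_set0.
have nu_ge0 A : 0 <= nu A by apply: integral_ge0 => x _; rewrite lee_fin.
have nus : semi_sigma_additive nu.
  move=> F mF tF mUF; rewrite /nu ge0_integral_bigcup//; last 2 first.
  - exact/measurable_funTS/measurable_EFinP.
  - by move=> x _; rewrite lee_fin.
  by apply: is_cvg_ereal_nneg_natsum_cond => n _ _;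
    apply: integral_ge0 => x _; rewrite lee_fin.
pose nu' : {measure set T -> \bar R} :=
  HB.pack nu (isMeasure.Build _ _ _ nu nu0 nu_ge0 nus).
by exists nu'.
Qed.

End density.

(** * Gluing a coupling with an empirical measure *)

Lemma probability_of_measure d (T : measurableType d) (R : realType)
    (mu : {measure set T -> \bar R}) : mu setT = 1%E ->
  exists P : probability T R, forall A, P A = mu A.
Proof.
move=> mu1; exists (mnormalize mu point) => A.
by rewrite /= /mnormalize mu1 onee_eq0/= invr1 mule1.
Qed.

Lemma sum_measure d (T : measurableType d) (R : realType) (N : nat)
    (mu : 'I_N -> {measure set T -> \bar R}) :
  exists nu : {measure set T -> \bar R},
    (forall A, nu A = \sum_(k < N) mu k A)%E /\
    (forall h : T -> \bar R, measurable_fun setT h -> (forall x, 0 <= h x)%E ->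
      \int[nu]_x h x = \sum_(k < N) \int[mu k]_x h x)%E.
Proof.
(* [msum] is indexed by the natural numbers: the family is extended by the zero measure. *)
pose mu' n : {measure set T -> \bar R} := oapp mu mzero (insub n).
have mu'E (k : 'I_N) : mu' k = mu k by rewrite /mu' valK.
exists (msum mu' N); split => [A|h mh h0].
  by rewrite /msum/=; apply: eq_bigr => k _; rewrite mu'E.
rewrite ge0_integral_measure_sum//.
by apply: eq_bigr => k _; rewrite mu'E.
Qed.

Section gluing.
Context {R : realType} {m : nat}.
Local Notation E := (borel_rV R m).
Variables (p : R) (p_ge1 : 1 <= p).

(* The weights [f k w] are the conditional probabilities of being sent from
   [X w] to the atom [y k]. *)
Lemma wasserstein_le_weights d (T : measurableType d) (mu : probability T R)
    (X : T -> E) (P : set E -> \bar R) (N : nat) (y : 'I_N -> E)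
    (f : 'I_N -> T -> R) (t : R) :
  measurable_fun setT X ->
  (forall A, measurable A -> mu (X @^-1` A) = P A) ->
  (forall k, measurable_fun setT (f k)) ->
  (forall k w, 0 <= f k w) -> (forall w, \sum_(k < N) f k w = 1) ->
  (forall k, \int[mu]_w (f k w)%:E = (N%:R^-1)%:E)%E ->
  0 <= t ->
  (\sum_(k < N) \int[mu]_w (enorm ((X w : 'rV[R]_m) - y k) `^ p * f k w)%:E
     <= (t `^ p)%:E)%E ->
  (wasserstein p P (empirical y) <= t%:E)%E.
Proof.
move=> mX XP mf f0 f1 fN t0 cost.
have [nu nuE] := choice (fun k => density_measure mu (mf k) (f0 k)).
have mg k : measurable_fun setT (fun w : T => (X w, y k) : E * E).
  by apply/measurable_fun_pairP; split => //; exact: measurable_cst.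
(* The plan is the sum over [k] of the images, under [w |-> (X w, y k)], of the measures with
   density [f k]. Its first marginal is [P] because the weights sum to 1; its second one puts mass
   [1/N] on each index. *)
pose nug k : {measure set (E * E)%type -> \bar R} :=
  pushforward (nu k) (fun w : T => (X w, y k) : E * E).
have [M [ME Mint]] := sum_measure (nug mg).
have sum_nu A : measurable A -> (\sum_(k < N) nu k A = mu A)%E.
  move=> mA; under eq_bigr do rewrite nuE//.
  rewrite -ge0_integral_sum//; last 2 first.
  - by move=> k; exact/measurable_funTS/measurable_EFinP.
  - by move=> k x _; rewrite lee_fin.
  under eq_integral do rewrite sumEFin f1.
  by rewrite integral_cst// mul1e.
have M1 : M setT = 1%E.
  by rewrite ME -(probability_setT mu) -(sum_nu setT).
have [gam gamE] := probability_of_measure M1.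
apply: (@wasserstein_le_cost _ _ _ p_ge1 _ _ _ gam) => //.
  move=> A mA; split.
    rewrite gamE ME -XP// -sum_nu//.
    by rewrite -[_ @^-1` _]setTI; exact: mX.
  rewrite gamE ME /empirical ge0_sume_distrr//.
  apply: eq_bigr => k _; rewrite /nug/= /pushforward diracE.
  have [yA|yA] := boolP (y k \in A).
    rewrite (_ : _ @^-1` _ = setT); first by rewrite nuE// fN mule1.
    by apply/seteqP; split => // w _ /=; exact: set_mem.
  rewrite (_ : _ @^-1` _ = set0); first by rewrite measure0 mule0.
  by apply/seteqP; split => // w /= yAw; move/negP: yA; apply; exact: mem_set.
have mc : measurable_fun setT
    (fun z : E * E => (enorm (z.1 - z.2 : 'rV[R]_m) `^ p)%:E).
  apply/measurable_EFinP; apply: (measurableT_comp (measurable_powR p)).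
  exact: measurable_enormB.
have -> : (\int[gam]_z (enorm (z.1 - z.2 : 'rV[R]_m) `^ p)%:E =
    \int[M]_z (enorm (z.1 - z.2 : 'rV[R]_m) `^ p)%:E)%E.
  by apply: eq_measure_integral => A mA _; exact: gamE.
rewrite Mint//; last by move=> z; rewrite lee_fin powR_ge0.
apply: le_trans cost; apply: lee_sum => k _.
rewrite ge0_integral_pushforward//; last by move=> z _; rewrite lee_fin powR_ge0.
rewrite preimage_setT.
rewrite (ge0_integral_density (mf k) (f0 k) (nuE k)).
- by under [leRHS]eq_integral do rewrite EFinM.
- exact: measurableT_comp.
- by move=> w; rewrite lee_fin powR_ge0.
Qed.

End gluing.

(** * Conditional weights by Radon-Nikodym *)

Section conditional_weights.
Local Open Scope ereal_scope.
Context d1 d2 (T : measurableType d1) (S : measurableType d2) (R : realType).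

(** Applied to the complement of [A], the domination gives the reverse inequality, since both total
    masses are 1. *)
Lemma probability_le_eq (mu nu : {measure set S -> \bar R}) :
  mu setT = 1 -> nu setT = 1 ->
  (forall A, measurable A -> nu A <= mu A) ->
  forall A, measurable A -> nu A = mu A.
Proof.
move=> /probability_of_measure[P PE] /probability_of_measure[Q QE] le_nu A mA.
apply/eqP; rewrite eq_le le_nu//=.
have := le_nu _ (measurableC mA).
rewrite -PE -QE -[nu A]QE -[mu A]PE !probability_setC//.
rewrite -(fineK (fin_num_measure P A mA)) -(fineK (fin_num_measure Q A mA)).
by rewrite -!EFinB !lee_fin; lra.
Qed.

(** The sum of the densities and the constant 1 have the same integral over every measurable set. *)
Lemma ae_eq_cst1_sum_density (mu : probability S R) (N : nat)
    (nu : 'I_N -> {measure set S -> \bar R}) (f : 'I_N -> S -> R) :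
  (forall k, measurable_fun setT (f k)) -> (forall k x, 0 <= f k x)%R ->
  (forall k A, measurable A -> nu k A = \int[mu]_(x in A) (f k x)%:E) ->
  (forall A, measurable A -> \sum_(k < N) nu k A = mu A) ->
  ae_eq mu setT (fun x => (\sum_(k < N) f k x)%:E) (cst 1).
Proof.
move=> mf f0 nuE nu_mu; apply: ae_eq_sym; apply: integral_ae_eq => //.
- exact: finite_measure_integrable_cst.
- by apply/measurable_EFinP; exact: measurable_sum.
- move=> A _ mA; rewrite integral_cst// mul1e.
  rewrite (_ : _ A = \sum_(k < N) nu k A); last by rewrite nu_mu.
  under eq_bigr do rewrite nuE//.
  rewrite -ge0_integral_sum//.
  + by apply: eq_integral => x _; rewrite sumEFin.
  + by move=> k; exact/measurable_funTS/measurable_EFinP.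
  + by move=> k x _; rewrite lee_fin.
Qed.

(** [wasserstein_le_weights] asks for weights that sum to 1 at every point. On the null set where
    this fails they are replaced by uniform ones, which changes no integral. *)
Lemma normalize_weights (mu : probability S R) (N : nat) (f : 'I_N -> S -> R) :
  (0 < N)%N ->
  (forall k, measurable_fun setT (f k)) -> (forall k x, 0 <= f k x)%R ->
  ae_eq mu setT (fun x => (\sum_(k < N) f k x)%:E) (cst 1) ->
  exists f' : 'I_N -> S -> R,
    [/\ forall k, measurable_fun setT (f' k), forall k x, (0 <= f' k x)%R,
        forall x, (\sum_(k < N) f' k x = 1)%R &
        forall k (h : S -> \bar R), measurable_fun setT h ->
          \int[mu]_x (h x * (f' k x)%:E) = \int[mu]_x (h x * (f k x)%:E)].
Proof.
move=> N0 mf f0 fae.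
pose s x := (\sum_(k < N) f k x)%R.
pose f' k x := (if s x == 1 then f k x else N%:R^-1)%R.
have mf' k : measurable_fun setT (f' k).
  apply: measurable_fun_ifT => //; apply: measurable_fun_eqr => //.
  exact: measurable_sum.
exists f'; split => //.
- by move=> k x; rewrite /f'; case: ifPn.
- move=> x; rewrite /f'; have [|_] := eqVneq (s x) 1%R; first exact.
  by rewrite /= sumr_const card_ord -[(_ *+ N)%R]mulr_natr mulVf// pnatr_eq0 -lt0n.
- move=> k h mh; apply: ae_eq_integral => //.
  + by apply: emeasurable_funM => //; exact/measurable_EFinP.
  + by apply: emeasurable_funM => //; exact/measurable_EFinP.
  + move: fae; apply: filterS => x /(_ Logic.I)/= [sx] _.
    by rewrite /f' /s sx eqxx.
Qed.

(* The weights [f k] are the conditional expectations of the [g k] given [X]. *)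
Lemma conditional_weights (gam : probability T R) (mu : probability S R)
    (X : T -> S) (N : nat) (g : 'I_N -> T -> R) :
  measurable_fun setT X ->
  (forall A, measurable A -> gam (X @^-1` A) = mu A) -> (0 < N)%N ->
  (forall k, measurable_fun setT (g k)) -> (forall k w, 0 <= g k w)%R ->
  (forall w, \sum_(k < N) g k w <= 1)%R ->
  (forall k, \int[gam]_w (g k w)%:E = (N%:R^-1)%:E) ->
  exists f : 'I_N -> S -> R,
    [/\ forall k, measurable_fun setT (f k), forall k x, (0 <= f k x)%R,
        forall x, (\sum_(k < N) f k x = 1)%R &
        forall k (h : S -> \bar R), measurable_fun setT h -> (forall x, 0 <= h x) ->
          \int[mu]_x (h x * (f k x)%:E) = \int[gam]_w (h (X w) * (g k w)%:E)].
Proof.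
move=> mX XE N0 mg g0 g1 gN.
have NR : (N%:R != 0 :> R)%R by rewrite pnatr_eq0 -lt0n.
have mXA A : measurable A -> measurable (X @^-1` A).
  by move=> mA; rewrite -[_ @^-1` _]setTI; exact: mX.
(* The factor [N] gives the measure with density [G k] mass 1, so that its image under [X] is a
   probability, to which Radon-Nikodym applies; [f] divides by [N] again. *)
pose G k w := (N%:R * g k w)%R.
have mG k : measurable_fun setT (G k) by exact: measurable_funM.
have G0 k w : (0 <= G k w)%R by rewrite mulr_ge0.
have [rho rhoE] := choice (fun k => density_measure gam (mG k) (G0 k)).
pose rhoX k : {measure set S -> \bar R} :=
  pushforward (rho k) X.
have rhoX1 k : rhoX mX k setT = 1.
  rewrite /= /pushforward preimage_setT rhoE//.
  under eq_integral do rewrite EFinM.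
  rewrite ge0_integralZl//; last 2 first.
  - exact/measurable_EFinP.
  - by move=> w _; rewrite lee_fin.
  by rewrite gN -EFinM divff.
have [nu nuE] := choice (fun k => probability_of_measure (rhoX1 k)).
have nu_mu k : nu k `<< mu.
  apply/null_content_dominatesP => A mA muA0.
  rewrite nuE /= /pushforward rhoE; last exact: mXA.
  apply: null_set_integral; [exact: mXA| |exact: etrans (XE _ mA) muA0].
  exact/measurable_funTS/measurable_EFinP.
have [F FE] := choice (fun k => radon_nikodym_sigma_finite (nu_mu k)).
pose f k x := (N%:R^-1 * fine (F k x))%R.
have mF k : measurable_fun setT (F k).
  by have [_ _ /measurable_int] := FE k.
have F0 k x : 0 <= F k x by have [] := FE k.
have fF0 k x : (0 <= fine (F k x))%R by exact: fine_ge0.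
have Ffin k x : F k x \is a fin_num by have [] := FE k.
have mfF k : measurable_fun setT (fun x => fine (F k x)).
  by apply: measurableT_comp => //; exact: measurable_fine.
have mf k : measurable_fun setT (f k) by exact: measurable_funM.
have f0 k x : (0 <= f k x)%R by rewrite mulr_ge0.
have nuF k A : measurable A -> nu k A = \int[mu]_(x in A) (fine (F k x))%:E.
  move=> mA; have [_ _ _ ->//] := FE k.
  by apply: eq_integral => x _; rewrite fineK.
have int_f k (h : S -> \bar R) : measurable_fun setT h -> (forall x, 0 <= h x) ->
    \int[mu]_x (h x * (f k x)%:E) = \int[gam]_w (h (X w) * (g k w)%:E).
  move=> mh h0.
  transitivity (\int[mu]_x ((N%:R^-1)%:E * (h x * (fine (F k x))%:E))).
    by apply: eq_integral => x _; rewrite /f EFinM muleCA.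
  rewrite ge0_integralZl//; last 2 first.
  - by apply: emeasurable_funM => //; exact/measurable_EFinP.
  - by move=> x _; rewrite mule_ge0// lee_fin.
  rewrite -(ge0_integral_density (mfF k) (fF0 k) (nuF k))//.
  rewrite (eq_measure_integral (rhoX mX k)); last by move=> A mA _; exact: nuE.
  rewrite ge0_integral_pushforward//.
  rewrite preimage_setT (ge0_integral_density (mG k) (G0 k) (rhoE k)); last 2 first.
  - exact: measurableT_comp.
  - by move=> w; exact: h0.
  rewrite -ge0_integralZl//; last 2 first.
  - apply: emeasurable_funM; first exact: measurableT_comp.
    exact/measurable_EFinP.
  - by move=> w _; apply: mule_ge0; [exact: h0|rewrite lee_fin].
  apply: eq_integral => w _.
  by rewrite muleCA; congr (_ * _); rewrite -EFinM /G mulKf.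
have [sg sgE] := choice (fun k => density_measure mu (mf k) (f0 k)).
have [sig [sigE _]] := sum_measure sg.
have sgX k A : measurable A ->
    sg k A = \int[gam]_(w in X @^-1` A) (g k w)%:E.
  move=> mA; rewrite sgE// integral_mkcond [RHS]integral_mkcond.
  have mI : measurable_fun setT (EFin \o \1_A : S -> \bar R).
    exact/measurable_EFinP/measurable_indic.
  transitivity (\int[mu]_x ((\1_A x)%:E * (f k x)%:E)).
    by apply: eq_integral => x _; rewrite patchE indicE; case: ifPn => _;
      rewrite ?mul1e ?mul0e.
  rewrite (int_f k (EFin \o \1_A))//; last by move=> x; rewrite lee_fin.
  apply: eq_integral => w _ /=; rewrite patchE indicE.
  have -> : (w \in X @^-1` A) = (X w \in A) by apply/idP/idP; rewrite !inE.
  by case: ifPn => _; rewrite ?mul1e ?mul0e.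
(* As the [g k] are only known to sum to at most 1, [sig] is first dominated by [mu]; its total mass
   [N * (1/N) = 1] then forces equality. *)
have sig_mu A : measurable A -> sig A = mu A.
  apply: probability_le_eq; first exact: probability_setT.
    rewrite sigE; under eq_bigr do rewrite sgX// preimage_setT gN.
    rewrite sumEFin sumr_const card_ord -[(_ *+ N)%R]mulr_natr mulVf//.
  move=> B mB; rewrite sigE.
  rewrite (_ : _ B = gam (X @^-1` B)); last by rewrite XE.
  under eq_bigr do rewrite sgX//.
  rewrite -ge0_integral_sum//; last 3 first.
  - exact: mXA.
  - by move=> k; exact/measurable_funTS/measurable_EFinP.
  - by move=> k w _; rewrite lee_fin.
  rewrite -[leRHS]mul1e -integral_cst; last exact: mXA.
  apply: ge0_le_integral => //.
  - exact: mXA.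
  - by move=> w _; apply: sume_ge0 => k _; rewrite lee_fin.
  - by apply: emeasurable_sum => k; exact/measurable_funTS/measurable_EFinP.
  - by move=> w _; rewrite sumEFin lee_fin.
have fae := ae_eq_cst1_sum_density mf f0 sgE
  (fun A mA => etrans (esym (sigE A)) (sig_mu A mA)).
have [f' [mf' f'0 f'1 f'int]] := normalize_weights N0 mf f0 fae.
exists f'; split => // k h mh h0.
by rewrite f'int// int_f.
Qed.

End conditional_weights.

Lemma ge0_integral_law d1 d2 (T : measurableType d1) (S : measurableType d2)
    (R : realType) (mu : {measure set T -> \bar R}) (P : {measure set S -> \bar R})
    (Z : T -> S) (h : S -> \bar R) :
  measurable_fun setT Z -> (forall A, measurable A -> mu (Z @^-1` A) = P A) ->
  measurable_fun setT h -> (forall x, 0 <= h x)%E ->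
  (\int[P]_x h x = \int[mu]_w h (Z w))%E.
Proof.
move=> mZ ZE mh h0.
pose ZP (_ : measurable_fun setT Z) : {measure set S -> \bar R} := pushforward mu Z.
rewrite (eq_measure_integral (ZP mZ mZ)); last by move=> A mA _; rewrite -ZE.
by rewrite ge0_integral_pushforward.
Qed.

(** * Weights extracted from a coupling *)

Section coupling_weights.
Context {R : realType} {m : nat}.
Local Notation E := (borel_rV R m).
Variable p : R.

Lemma measurable_set1_rV (a : E) : measurable [set a].
Proof.
have mf : measurable_fun setT (fun x : E => enorm ((x : 'rV[R]_m) - a)).
  apply: measurable_enormB; first exact: measurable_id.
  exact: measurable_cst.
have -> : [set a] = setT `&` (fun x : E => enorm ((x : 'rV[R]_m) - a)) @^-1` [set 0].
  rewrite setTI; apply/seteqP; split => x /=.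
    by move=> ->; rewrite subrr enorm0.
  by move=> /enorm_eq0/eqP; rewrite subr_eq0 => /eqP.
exact: mf.
Qed.

Lemma measurable_enormB_powR d (T : measurableType d) (f g : T -> E) :
  measurable_fun setT f -> measurable_fun setT g ->
  measurable_fun setT (fun t => (enorm ((f t : 'rV[R]_m) - g t) `^ p)%:E).
Proof.
move=> mf mg; apply/measurable_EFinP.
apply: (measurableT_comp (measurable_powR p)).
exact: measurable_enormB.
Qed.

(** A converse to [wasserstein_le_weights]: the second coordinate of the coupling is read as a
    random index, whose conditional law given the first coordinate provides the weights. *)
Lemma coupling_weights (mu : probability E R) (N : nat) (y : 'I_N -> E)
    (gam : probability (E * E)%type R) :
  (0 < N)%N -> coupling mu (empirical y) gam ->
  exists f : 'I_N -> E -> R,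
    [/\ forall k, measurable_fun setT (f k), forall k x, 0 <= f k x,
        forall x, \sum_(k < N) f k x = 1,
        forall k, (\int[mu]_x (f k x)%:E = (N%:R^-1)%:E)%E &
        (\sum_(k < N) \int[mu]_x
            ((enorm ((x : 'rV[R]_m) - y k) `^ p)%:E * (f k x)%:E)
         <= \int[gam]_z (enorm (z.1 - z.2 : 'rV[R]_m) `^ p)%:E)%E].
Proof.
move=> N0 gamC.
have in_set1E (a x : E) : (x \in [set a]) = ((x : 'rV[R]_m) == a).
  by apply/idP/eqP; rewrite inE.
pose mult (x : E) : R := \sum_(l < N) \1_[set x] (y l).
(* [g k z] splits the mass that [gam] puts on the atom [y k] evenly between the
   indices at which [y] takes the value [y k]. *)
pose g (k : 'I_N) (z : E * E) : R := (mult (y k))^-1 * \1_[set y k] z.2.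
have mult0 x : 0 <= mult x by rewrite sumr_ge0.
have mult_neq0 k : mult (y k) != 0.
  rewrite gt_eqF// /mult (bigD1 k)//= indicE mem_set// ltr_pwDl//.
  by rewrite sumr_ge0.
(* With the multiplicity taken at [z.2], the factor is common to all [k]: the [g k z] sum to 1 if
   [z.2] is a sample point and to 0 otherwise. *)
have gE k z : g k z = (mult z.2)^-1 * \1_[set z.2] (y k).
  rewrite /g !indicE !in_set1E eq_sym.
  by have [->|_] := eqVneq (y k : 'rV[R]_m) z.2; rewrite ?mulr0.
have m1 (a : E) : measurable_fun setT (\1_[set a] : E -> R).
  by apply: measurable_indic; exact: measurable_set1_rV.
have m1snd (a : E) : measurable_fun setT (fun z : E * E => \1_[set a] z.2 : R).
  by apply: (measurableT_comp (m1 a)); exact: measurable_snd.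
have mg k : measurable_fun setT (g k) by apply: measurable_funM.
have g0 k z : 0 <= g k z by rewrite mulr_ge0 ?invr_ge0.
have g1 z : \sum_(k < N) g k z <= 1.
  under eq_bigr do rewrite gE.
  rewrite -mulr_sumr -/(mult z.2).
  by have [->|mz] := eqVneq (mult z.2) 0; rewrite ?mulr0// mulVf.
have gN k : (\int[gam]_z (g k z)%:E = (N%:R^-1)%:E)%E.
  under eq_integral do rewrite EFinM.
  rewrite ge0_integralZl//; last 2 first.
  - by apply/measurable_EFinP; exact: m1snd.
  - by rewrite lee_fin invr_ge0.
  have msnd : measurable (snd @^-1` [set y k] : set (E * E)).
    by rewrite -[_ @^-1` _]setTI; apply: measurable_snd => //; exact: measurable_set1_rV.
  have -> : (\int[gam]_z (\1_[set y k] z.2)%:E =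
      \int[gam]_z (\1_(snd @^-1` [set y k] : set (E * E)) z)%:E)%E.
    by apply: eq_integral => z _; rewrite !indicE; congr (_%:R%:E);
      apply/idP/idP; rewrite !inE.
  rewrite integral_indic// setIT.
  (* The empirical measure gives the point [y k] mass [mult (y k) / N], so the multiplicity
     cancels. *)
  transitivity (((mult (y k))^-1)%:E * empirical y [set y k])%E.
    by congr (_ * _)%E; have [] := gamC _ (measurable_set1_rV (y k)).
  rewrite /empirical; under eq_bigr do rewrite /dirac.
  by rewrite sumEFin -/(mult (y k)) -!EFinM mulrCA mulVf// mulr1.
have gam_mu A : measurable A -> gam (fst @^-1` A) = mu A.
  by move=> mA; have [] := gamC _ mA.
have [f [mf f0 f1 fg]] :=
  conditional_weights measurable_fst gam_mu N0 mg g0 g1 gN.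
exists f; split => //.
  move=> k; have := fg k (cst 1%E) (measurable_cst _) (fun=> lee01).
  by rewrite -(gN k); under eq_integral do rewrite mul1e;
    under [in RHS]eq_integral do rewrite mul1e.
have mc : measurable_fun setT
    (fun z : E * E => (enorm (z.1 - z.2 : 'rV[R]_m) `^ p)%:E).
  exact: measurable_enormB_powR.
under eq_bigr => k _.
  rewrite (fg k (fun x => (enorm ((x : 'rV[R]_m) - y k) `^ p)%:E)); last 2 first.
  - by apply: measurable_enormB_powR; [exact: measurable_id|exact: measurable_cst].
  - by move=> x; rewrite lee_fin powR_ge0.
  (* Where [g k z] is nonzero, [z.2 = y k], so the two costs coincide. *)
  rewrite (_ : (\int[gam]_w _ = \int[gam]_z
    ((enorm (z.1 - z.2 : 'rV[R]_m) `^ p)%:E * (g k z)%:E))%E); last first.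
    apply: eq_integral => z _; rewrite /g indicE in_set1E.
    by have [->//|_] := eqVneq (z.2 : 'rV[R]_m) (y k); rewrite mulr0 !mule0.
  over.
rewrite -ge0_integral_sum//; last 2 first.
- by move=> k; apply: emeasurable_funM => //; exact/measurable_EFinP.
- by move=> k z _; rewrite mule_ge0// lee_fin ?powR_ge0.
apply: ge0_le_integral => //.
- by move=> z _; apply: sume_ge0 => k _; rewrite mule_ge0// lee_fin ?powR_ge0.
- by apply: emeasurable_sum => k; apply: emeasurable_funM => //; exact/measurable_EFinP.
- move=> z _; rewrite -ge0_sume_distrr; last by move=> k _; rewrite lee_fin.
  by rewrite sumEFin -EFinM lee_fin ler_piMr// powR_ge0.
Qed.

End coupling_weights.

(** * The Wasserstein distance to an empirical measure *)

Section wasserstein_empirical.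
Context {R : realType} {m : nat}.
Local Notation E := (borel_rV R m).
Variables (p : R) (p_ge1 : 1 <= p).

Lemma wasserstein_ge0 (mu nu : set E -> \bar R) : (0 <= wasserstein p mu nu)%E.
Proof. exact: poweR_ge0. Qed.

(** A nearly optimal plan from [P] to [y] is reused: [X w] is sent to [y' k] with the weight
    [f k (Z w)] that the plan gives to [Z w]. The excess distance [b] adds at most its p-norm.
    Moving the sample points and the triangle inequality are both instances. *)
Lemma wasserstein_transport d (T : measurableType d) (mu : probability T R)
    (Z X : T -> E) (P : probability E R) (Q : set E -> \bar R)
    (N : nat) (y y' : 'I_N -> E) (b : T -> R) (s t : R) :
  (0 < N)%N -> measurable_fun setT Z -> measurable_fun setT X ->
  (forall A, measurable A -> mu (Z @^-1` A) = P A) ->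
  (forall A, measurable A -> mu (X @^-1` A) = Q A) ->
  measurable_fun setT b -> (forall w, 0 <= b w) ->
  (forall k w, enorm ((X w : 'rV[R]_m) - y' k) <=
               enorm ((Z w : 'rV[R]_m) - y k) + b w) ->
  (wasserstein p P (empirical y) <= s%:E)%E ->
  0 <= t -> (\int[mu]_w (b w `^ p)%:E <= (t `^ p)%:E)%E ->
  (wasserstein p Q (empirical y') <= (s + t)%:E)%E.
Proof.
move=> N0 mZ mX ZP XQ mb b0 tri Ws t0 bt.
have s0 : 0 <= s by rewrite -lee_fin (le_trans (wasserstein_ge0 _ _) Ws).
(* Half of [e] goes to each radius: both become positive, as [powRD_le_combination] requires, and
   [s1] exceeds [s] strictly, so that a coupling can be picked. *)
apply/lee_addgt0Pr => e e0.
have e20 : 0 < e / 2 by rewrite divr_gt0.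
pose s1 := s + e / 2; pose t1 := t + e / 2.
have s10 : 0 < s1 by rewrite ltr_wpDl.
have t10 : 0 < t1 by rewrite ltr_wpDl.
have [gam gamC gams] : exists2 gam, coupling P (empirical y) gam &
    (\int[gam]_z (enorm (z.1 - z.2 : 'rV[R]_m) `^ p)%:E <= (s1 `^ p)%:E)%E.
  by apply: (wasserstein_cost_lt p_ge1 Ws); rewrite ltrDl.
have [f [mf f0 f1 fN fcost]] := coupling_weights p N0 gamC.
have [c1 [c2 [c10 c20 cE cle]]] := powRD_le_combination p_ge1 s10 t10.
have -> : (s + t)%:E + e%:E = (s1 + t1)%:E :> \bar R.
  by rewrite -EFinD; congr EFin; rewrite /s1 /t1; lra.
have mfZ k : measurable_fun setT (fun w => f k (Z w)).
  exact: measurableT_comp (mf k) mZ.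
apply: (@wasserstein_le_weights _ _ _ p_ge1 _ _ mu X _ _ _ (fun k w => f k (Z w))) => //.
- move=> k; rewrite -(fN k); apply/esym.
  apply: (@ge0_integral_law _ _ _ _ _ mu P Z (EFin \o f k)) => //.
    exact/measurable_EFinP.
  by move=> x; rewrite lee_fin.
- by rewrite addr_ge0// ltW.
have mZc k : measurable_fun setT (fun w => (enorm ((Z w : 'rV[R]_m) - y k) `^ p)%:E).
  by apply: measurable_enormB_powR => //; exact: measurable_cst.
have mZf k : measurable_fun setT
    (fun w => (enorm ((Z w : 'rV[R]_m) - y k) `^ p)%:E * (f k (Z w))%:E)%E.
  by apply: emeasurable_funM => //; exact/measurable_EFinP.
have mbp : measurable_fun setT (fun w => (b w `^ p)%:E).
  by apply/measurable_EFinP; apply: (measurableT_comp (measurable_powR p)).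
have mbf k : measurable_fun setT (fun w => (b w `^ p)%:E * (f k (Z w))%:E)%E.
  by apply: emeasurable_funM => //; exact/measurable_EFinP.
have Zf0 k w : (0 <= (enorm ((Z w : 'rV[R]_m) - y k) `^ p)%:E * (f k (Z w))%:E)%E.
  by rewrite mule_ge0// lee_fin ?powR_ge0.
have bf0 k w : (0 <= (b w `^ p)%:E * (f k (Z w))%:E)%E.
  by rewrite mule_ge0// lee_fin ?powR_ge0.
have step k : (\int[mu]_w (enorm ((X w : 'rV[R]_m) - y' k) `^ p * f k (Z w))%:E <=
    c1%:E * (\int[mu]_w ((enorm ((Z w : 'rV[R]_m) - y k) `^ p)%:E * (f k (Z w))%:E))
    + c2%:E * (\int[mu]_w ((b w `^ p)%:E * (f k (Z w))%:E)))%E.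
  rewrite -!ge0_integralZl// -ge0_integralD//.
  - apply: ge0_le_integral => //.
    + by move=> w _; rewrite lee_fin mulr_ge0// powR_ge0.
    + apply/measurable_EFinP; apply: measurable_funM => //.
      apply: (measurableT_comp (measurable_powR p)).
      by apply: measurable_enormB => //; exact: measurable_cst.
    + by apply: emeasurable_funD; exact: measurable_funeM.
    + move=> w _; rewrite -!EFinM -EFinD lee_fin !mulrA -mulrDl ler_wpM2r//.
      apply: le_trans (cle _ _ (enorm_ge0 _) (b0 w)).
      by apply: ge0_ler_powR; rewrite ?nnegrE ?addr_ge0 ?enorm_ge0// (le_trans _ p_ge1).
  - by move=> w _; rewrite mule_ge0// lee_fin.
  - exact: measurable_funeM.
  - by move=> w _; rewrite mule_ge0// lee_fin.
  - exact: measurable_funeM.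
apply: (le_trans (lee_sum _ (fun k _ => step k))).
rewrite big_split/= -!ge0_sume_distrr; last 2 first.
- by move=> k _; apply: integral_ge0.
- by move=> k _; apply: integral_ge0.
rewrite -cE EFinD !EFinM; apply: leeD; apply: lee_wpmul2l; rewrite ?lee_fin//.
  apply: le_trans gams; apply: le_trans fcost; apply: lee_sum => k _.
  rewrite (@ge0_integral_law _ _ _ _ _ mu P Z
    (fun x => (enorm ((x : 'rV[R]_m) - y k) `^ p)%:E * (f k x)%:E)%E)//.
    apply: emeasurable_funM; last exact/measurable_EFinP.
    by apply: measurable_enormB_powR; [exact: measurable_id|exact: measurable_cst].
  by move=> x; rewrite mule_ge0// lee_fin ?powR_ge0.
rewrite -ge0_integral_sum//.
under eq_integral => w _.
  rewrite -ge0_sume_distrr; last by move=> k _; rewrite lee_fin.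
  rewrite sumEFin f1 mule1; over.
apply: (le_trans bt); rewrite lee_fin.
by apply: ge0_ler_powR; rewrite ?nnegrE ?(ltW t10) ?(le_trans _ p_ge1)// lerDl ltW.
Qed.

(** Transport with both maps the identity and a constant excess [r]. *)
Lemma wasserstein_move_sample (P : probability E R) (N : nat)
    (y y' : 'I_N -> E) (s r : R) :
  (0 < N)%N -> 0 <= r ->
  (forall k, enorm ((y k : 'rV[R]_m) - y' k) <= r) ->
  (wasserstein p P (empirical y) <= s%:E)%E ->
  (wasserstein p P (empirical y') <= (s + r)%:E)%E.
Proof.
move=> N0 r0 yy' Ws.
apply: (@wasserstein_transport _ _ P id id P P _ y y' (cst r)) => //.
- by move=> k w; rewrite (le_trans (enormB_triangle _ (y k) _))// lerD2l.
- by rewrite (integral_cst P measurableT (r `^ p)%:E) [X in (_ * X <= _)%E]probability_setT mule1.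
Qed.

(** The underlying probability space is a nearly optimal coupling of [Q] and [P]; the two maps are
    its coordinates and the excess is the distance between them. *)
Lemma wasserstein_empirical_triangle (P Q : probability E R) (N : nat)
    (y : 'I_N -> E) (s t : R) :
  (0 < N)%N ->
  (wasserstein p Q P <= t%:E)%E -> (wasserstein p P (empirical y) <= s%:E)%E ->
  (wasserstein p Q (empirical y) <= (s + t)%:E)%E.
Proof.
move=> N0 Wt Ws; apply/lee_addgt0Pr => e e0.
have t0 : 0 <= t by rewrite -lee_fin (le_trans (wasserstein_ge0 _ _) Wt).
have [gam gamC gamt] : exists2 gam, coupling Q P gam &
    (\int[gam]_z (enorm (z.1 - z.2 : 'rV[R]_m) `^ p)%:E <= ((t + e) `^ p)%:E)%E.
  by apply: (wasserstein_cost_lt p_ge1 Wt); rewrite ltrDl.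
rewrite -EFinD -addrA.
apply: (@wasserstein_transport _ _ gam snd fst P Q _ y y
  (fun z => enorm (z.1 - z.2 : 'rV[R]_m))) => //.
- by move=> A mA; have [] := gamC _ mA.
- by move=> A mA; have [] := gamC _ mA.
- exact: measurable_enormB.
- by move=> z; exact: enorm_ge0.
- by move=> k z; rewrite [leRHS]addrC; exact: enormB_triangle.
- by rewrite addr_ge0// ltW.
Qed.

(** Nearly optimal couplings of the [P i] with [nu] are averaged with the weights [a]; the second
    marginal stays [nu] because the weights sum to 1. *)
Lemma wasserstein_mixture (n : nat) (a : 'I_n -> R) (P : 'I_n -> probability E R)
    (Q : probability E R) (nu : set E -> \bar R) (s : R) :
  simplex a -> is_mixture a P Q ->
  (forall A, measurable A -> nu A \is a fin_num) -> 0 <= s ->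
  (forall i, wasserstein p (P i) nu <= s%:E)%E ->
  (wasserstein p Q nu <= s%:E)%E.
Proof.
move=> [a0 a1] QE nufin s0 Ws; apply/lee_addgt0Pr => e e0.
have se0 : 0 <= s + e by rewrite addr_ge0// ltW.
have gam_ex i : exists gam, coupling (P i) nu gam /\
    (\int[gam]_z (enorm (z.1 - z.2 : 'rV[R]_m) `^ p)%:E <= ((s + e) `^ p)%:E)%E.
  have [|gam] := wasserstein_cost_lt p_ge1 (Ws i) (t := s + e); first by rewrite ltrDl.
  by exists gam.
have [gam gamE] := choice gam_ex.
pose sgam i : {measure set (E * E)%type -> \bar R} := mscale (NngNum (a0 i)) (gam i).
have [M [ME Mint]] := sum_measure sgam.
have M1 : M setT = 1%E.
  rewrite ME; under eq_bigr do rewrite /sgam/= /mscale/= probability_setT mule1.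
  by rewrite sumEFin a1.
have [g gE] := probability_of_measure M1.
rewrite -EFinD; apply: (@wasserstein_le_cost _ _ _ p_ge1 _ _ _ g) => //.
  move=> A mA; rewrite !gE !ME; split.
    by rewrite QE//; apply: eq_bigr => i _; have [/(_ _ mA)[<-]] := gamE i.
  rewrite (eq_bigr (fun i => (a i)%:E * nu A)%E); last first.
    by move=> i _; have [/(_ _ mA)[_ <-]] := gamE i.
  rewrite -(fineK (nufin _ mA)); under eq_bigr do rewrite -EFinM.
  by rewrite sumEFin -mulr_suml a1 mul1r.
have mc : measurable_fun setT
    (fun z : E * E => (enorm (z.1 - z.2 : 'rV[R]_m) `^ p)%:E).
  exact: measurable_enormB_powR.
rewrite (eq_measure_integral M); last by move=> A mA _; exact: gE.
rewrite Mint//; last by move=> z; rewrite lee_fin powR_ge0.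
rewrite [leRHS](_ : _ = \sum_(i < n) (a i)%:E * ((s + e) `^ p)%:E)%E; last first.
  by under [RHS]eq_bigr do rewrite -EFinM; rewrite sumEFin -mulr_suml a1 mul1r.
apply: lee_sum => i _; rewrite ge0_integral_mscale//; last first.
  by move=> z _; rewrite lee_fin powR_ge0.
by apply: lee_wpmul2l; rewrite ?lee_fin//; have [] := gamE i.
Qed.

Lemma probability_empirical (N : nat) (y : 'I_N -> E) : (0 < N)%N ->
  exists P : probability E R, forall A, P A = empirical y A.
Proof.
move=> N0; apply: probability_of_measure.
rewrite /= /empirical; under eq_bigr do rewrite diracT.
by rewrite sumEFin sumr_const card_ord -EFinM mulVf// pnatr_eq0 -lt0n.
Qed.

Lemma wasserstein_refl (P : probability E R) (t : R) : 0 <= t ->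
  (wasserstein p P P <= t%:E)%E.
Proof.
move=> t0.
have mD : measurable_fun setT (fun x : E => (x, x) : E * E).
  by apply: measurable_fun_pair; exact: measurable_id.
pose D (_ : measurable_fun setT (fun x : E => (x, x) : E * E)) :
  {measure set (E * E)%type -> \bar R} := pushforward P (fun x : E => (x, x) : E * E).
have D1 : D mD mD setT = 1%E by rewrite /D/= /pushforward preimage_setT probability_setT.
have [g gE] := probability_of_measure D1.
apply: (@wasserstein_le_cost _ _ _ p_ge1 _ _ _ g) => //.
rewrite (eq_measure_integral (D mD mD)); last by move=> A mA _; exact: gE.
rewrite ge0_integral_pushforward//; last 2 first.
- exact: measurable_enormB_powR.
- by move=> z _; rewrite lee_fin powR_ge0.
rewrite preimage_setT integral0_eq ?lee_fin ?powR_ge0// => x _ /=.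
by rewrite subrr enorm0 powR0// gt_eqF// (lt_le_trans _ p_ge1).
Qed.

End wasserstein_empirical.

(** * Measurability of the distance to a random empirical measure *)

Section wasserstein_measurability.
Context {R : realType} {m : nat}.
Local Notation E := (borel_rV R m).

Lemma enorm_rat_dense (x : 'rV[R]_m) (r : R) : 0 < r ->
  exists q : 'rV[rat]_m, enorm (x - map_mx ratr q) < r.
Proof.
(* With [m] coordinates off by less than [r / (m + 1)], the squared distance is at most
   [m * r^2 / (m + 1)^2], which is below [r^2] even for [m = 0]. *)
move=> r0; pose e := r / m.+1%:R.
have e0 : 0 < e by rewrite divr_gt0.
have q_ex i : exists q : rat, `|x ord0 i - ratr q| < e.
  have [q] : exists q : rat, ratr q \in `](x ord0 i - e), (x ord0 i + e)[.
    by apply: rat_in_itvoo; rewrite ltrBlDr -addrA ltrDl addr_gt0.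
  rewrite in_itv/= => /andP[q1 q2]; exists q.
  by rewrite ltr_norml; apply/andP; split; lra.
have [q qE] := choice q_ex.
exists (\row_i q i); rewrite -(@ltr_pXn2r _ 2)// ?nnegrE ?enorm_ge0 ?ltW//.
rewrite sqr_enorm (@le_lt_trans _ _ (\sum_(i < m) e ^+ 2))//.
  apply: ler_sum => i _; rewrite !mxE -real_normK ?num_real//.
  by rewrite ler_pXn2r ?nnegrE// ltW.
rewrite sumr_const card_ord -[_ *+ m]mulr_natr /e expr_div_n mulrAC ltr_pdivrMr.
  rewrite ltr_pM2l ?exprn_gt0// -natrX ltr_nat.
  by rewrite expnS expn1 mulSn ltn_addr.
by rewrite exprn_gt0.
Qed.

Variables (p : R) (p_ge1 : 1 <= p).

(* By Lipschitz dependence on the sample points, the sublevel set is described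
   through the countably many samples with rational coordinates. *)
Lemma measurable_wasserstein_le d (T : measurableType d) (P : probability E R)
    (N : nat) (X : 'I_N -> T -> E) (e : R) : (0 < N)%N ->
  (forall k, measurable_fun setT (X k)) ->
  measurable [set w | (wasserstein p P (empirical (fun k => X k w)) <= e%:E)%E].
Proof.
move=> N0 mX.
pose emb (q : {ffun 'I_N -> 'rV[rat]_m}) (k : 'I_N) : E := map_mx ratr (q k).
pose B (j : nat) (q : {ffun 'I_N -> 'rV[rat]_m}) : set T :=
  [set w | (wasserstein p P (empirical (emb q)) <= (e + j.+1%:R^-1)%:E)%E /\
           forall k, enorm ((X k w : 'rV[R]_m) - emb q k) < j.+1%:R^-1].
rewrite [X in measurable X](_ : _ = \bigcap_j \bigcup_q B j q).
  apply: bigcapT_measurable => j; apply: countable_bigcupT_measurable => // q.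
  have mk k : measurable [set w | enorm ((X k w : 'rV[R]_m) - emb q k) < j.+1%:R^-1].
    have mlt : measurable_fun setT
        (fun w => enorm ((X k w : 'rV[R]_m) - emb q k) < j.+1%:R^-1).
      by apply: measurable_fun_ltr => //; apply: measurable_enormB => //;
        exact: measurable_cst.
    by have := mlt measurableT [set true] Logic.I; rewrite setTI.
  (* The first condition of [B j q] does not involve [w], so this set is either empty or a finite
     intersection of conditions on single sample points. *)
  have [Wq|Wq] := pselect
      (wasserstein p P (empirical (emb q)) <= (e + j.+1%:R^-1)%:E)%E.
    rewrite (_ : B j q = \bigcap_(k in [set: 'I_N])
       [set w | enorm ((X k w : 'rV[R]_m) - emb q k) < j.+1%:R^-1]).
      by apply: fin_bigcap_measurable.
    apply/seteqP; split => w.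
      by move=> [_ Xw] k _; exact: Xw.
    by move=> Xw; split => // k; exact: Xw.
  by rewrite (_ : B j q = set0)//; apply/seteqP; split => w // [].
apply/seteqP; split => w /= Xw.
  move=> j _; have j0 : 0 < j.+1%:R^-1 :> R by rewrite invr_gt0.
  have [q qE] := choice (fun k => enorm_rat_dense (X k w) j0).
  have embE k : emb [ffun k => q k] k = map_mx ratr (q k) by rewrite /emb ffunE.
  exists [ffun k => q k] => //; split; last by move=> k; rewrite embE.
  apply: (wasserstein_move_sample p_ge1 N0 (ltW j0) _ Xw) => k.
  by rewrite embE ltW.
(* Returning from the rational sample costs [1/(j+1)] a second time, hence the choice
   [1/(j+1) < r/2]. *)
apply/lee_addgt0Pr => r r0.
have [j] := @ltr_add_invr R 0 (r / 2) (divr_gt0 r0 (ltr0Sn _ 1)).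
rewrite add0r => jr; have [q _ [Wq Xq]] := Xw j Logic.I.
have j0 : 0 <= j.+1%:R^-1 :> R by rewrite invr_ge0.
have qX k : enorm ((emb q k : 'rV[R]_m) - X k w) <= j.+1%:R^-1.
  by rewrite -enormN opprB ltW.
apply: (le_trans (wasserstein_move_sample p_ge1 N0 j0 qX Wq)).
by rewrite -EFinD lee_fin -addrA lerD2l (splitr r) lerD// ltW.
Qed.

(** [measurable_wasserstein_le] is applied to [Om] equipped with the sigma-algebra generated by the
    sample itself, for which each [X k] is measurable by construction. *)
Lemma g_sigma_preimage_wasserstein_le (Om : pointedType) (P : probability E R)
    (N : nat) (X : 'I_N -> Om -> E) (e : R) : (0 < N)%N ->
  g_sigma_preimage X
    [set w | (wasserstein p P (empirical (fun k => X k w)) <= e%:E)%E].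
Proof.
move=> N0.
pose G := \big[setU/set0]_(i < N) preimage_set_system setT (X i) measurable.
apply: (@measurable_wasserstein_le _ (g_sigma_algebraType G) P N X e N0) => k.
move=> _ A mA; apply: sub_sigma_algebra.
rewrite /G (bigD1 k)//=; left; exists A => //.
Qed.

End wasserstein_measurability.

(** * Membership in the global ambiguity set *)

Section compact_support.
Context {R : realType} {m : nat}.
Local Notation E := (borel_rV R m).
Variable Xi : set 'rV[R]_m.
Hypothesis Xi_compact : compact Xi.

Lemma compact_measurable_rV : measurable (Xi : set E).
Proof.
rewrite -[Xi]setCK; apply: measurableC; apply: sub_sigma_algebra.
by apply: closed_openC; apply: compact_closed => //; exact: norm_hausdorff.
Qed.

Lemma compact_enorm_bounded : exists C : R, forall x, Xi x -> enorm x <= C.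
Proof.
have [M [_ MXi]] := compact_bounded Xi_compact.
have bound x : Xi x -> `|x| <= M + 1 by apply: MXi; rewrite ltrDl.
exists (Num.sqrt (\sum_(i < m) (M + 1) ^+ 2)) => x Xix.
apply: ler_wsqrtr; apply: ler_sum => i _.
have xM : `|x ord0 i| <= M + 1.
  apply: le_trans (bound x Xix).
  rewrite [leRHS]/Num.Def.normr/= mx_normrE.
  exact: (le_bigmax _ _ (ord0, i)).
by rewrite -real_normK ?num_real// ler_pXn2r// nnegrE (le_trans _ xM).
Qed.

(** The norm is bounded on [Xi], which carries all the mass, so the moment condition is
    automatic. *)
Lemma distributions_compact (p : R) (mu : probability E R) : 0 <= p ->
  mu Xi = 1%E -> distributions p Xi mu.
Proof.
move=> p0 muXi; split => //.
have [C CXi] := compact_enorm_bounded.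
have mn : measurable_fun setT (fun x : E => (enorm (x : 'rV[R]_m) `^ p)%:E).
  have := @measurable_enormB_powR R m p _ _ (@id E) (cst (0 : 'rV[R]_m))
    (@measurable_id _ _ _) (measurable_cst _).
  by under eq_fun do rewrite /= subr0.
apply: (@le_lt_trans _ _ (\int[mu]_x (`|C| `^ p)%:E)%E); last first.
  by rewrite (integral_cst mu measurableT (`|C| `^ p)%:E)
    [X in (_ * X)%E]probability_setT mule1 ltry.
apply: ae_ge0_le_integral => //.
- by move=> x _; rewrite lee_fin powR_ge0.
exists (~` Xi); split.
- by apply: measurableC; exact: compact_measurable_rV.
- apply: etrans (probability_setC mu compact_measurable_rV) _.
  by rewrite [X in (_ - X)%E]muXi subee.
- move=> x /= /not_implyP[_ xC] Xix; apply: xC; rewrite lee_fin.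
  apply: ge0_ler_powR; rewrite ?nnegrE ?enorm_ge0//.
  by rewrite (le_trans (CXi _ Xix))// ler_norm.
Qed.

End compact_support.

(** This is unconditional: [sup] is 0 when no supremum exists, and a power is nonnegative whatever
    its base. *)
Lemma conc_radius_ge0 (R : realType) (m : nat) (p c1 c2 : R) (Xi : set 'rV[R]_m)
  (N : nat) (b : R) : 0 <= conc_radius p c1 c2 Xi N b.
Proof.
have Xi0 : 0 <= half_diam_inf Xi.
  rewrite divr_ge0//; set S := (X in sup X).
  have [[[r Sr] Sub]|/sup_out->//] := pselect (has_sup S).
  rewrite (@le_trans _ _ r)//; last exact: ub_le_sup.
  by move: Sr => [z _ <-].
rewrite /conc_radius; case: ifPn => _; apply: mulr_ge0 => //; exact: powR_ge0.
Qed.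

Lemma lee_prod (R : realDomainType) (n : nat) (a b : 'I_n -> \bar R) :
  (forall i, 0 <= a i <= b i)%E ->
  (\prod_(i < n) a i <= \prod_(i < n) b i)%E.
Proof.
move=> ab.
suff /andP[] : (0 <= \prod_(i < n) a i <= \prod_(i < n) b i)%E by [].
apply: (big_ind2 (fun x y : \bar R => 0 <= x <= y)%E) => //.
- by rewrite lee01 lexx.
- move=> x1 x2 y1 y2 /andP[x10 x12] /andP[y10 y12].
  by rewrite mule_ge0// lee_pmul.
Qed.

Section sampling_probability.
Context {R : realType} {d : measure_display} {Om : measurableType d}.
Variable Pr : probability Om R.

Lemma independent_bigcap (n : nat) (F : 'I_n -> set (set Om)) (A : 'I_n -> set Om) :
  mutually_independent Pr F -> (forall i, F i (A i)) ->
  Pr (\bigcap_i A i) = (\prod_(i < n) Pr (A i))%E.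
Proof.
move=> indF FA; have := indF [set: 'I_n]%SET A (fun i _ => FA i).
rewrite (_ : [set` [set: 'I_n]%SET] = setT); last first.
  by apply/seteqP; split => i //= _; rewrite inE.
by move=> ->; apply: eq_bigl => i; rewrite inE.
Qed.

Lemma inner_prob_ge (A B : set Om) : measurable B -> B `<=` A ->
  (Pr B <= inner_prob Pr A)%E.
Proof. by move=> mB BA; apply: ereal_sup_ubound; exists B. Qed.

(** Removing from [B] a null set that contains the exceptions leaves a measurable subset of [A] with
    no less probability. *)
Lemma inner_prob_ae_ge (A B : set Om) : measurable B ->
  {ae Pr, forall w, B w -> A w} -> (Pr B <= inner_prob Pr A)%E.
Proof.
move=> mB [Z [mZ Z0 BAZ]].
have mBZ : measurable (B `\` Z) by exact: measurableD.
apply: (@le_trans _ _ (Pr (B `\` Z))).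
  apply: (@le_trans _ _ (Pr (B `\` Z `|` Z))).
    apply: le_measure; rewrite ?inE//; first exact: measurableU.
    by move=> w Bw; have [Zw|Zw] := pselect (Z w); [right|left].
  have := measureU2 Pr mBZ mZ.
  by rewrite [X in (_ + X)%E]Z0 adde0.
apply: inner_prob_ge => //.
by move=> w [Bw Zw]; apply: contrapT => Aw; apply: Zw; apply: BAZ => /= /(_ Bw).
Qed.

End sampling_probability.

Section global_ambiguity.
Context {R : realType} {m : nat}.
Local Notation E := (borel_rV R m).
Variables (p : R) (p_ge1 : 1 <= p) (Xi : set 'rV[R]_m) (Xi_compact : compact Xi).

Lemma mixture_support (n : nat) (a : 'I_n -> R) (P : 'I_n -> probability E R)
    (Q : probability E R) : simplex a -> is_mixture a P Q ->
  (forall i, P i Xi = 1%E) -> Q Xi = 1%E.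
Proof.
move=> [_ a1] QE P1; rewrite QE; last exact: compact_measurable_rV.
by under eq_bigr do rewrite P1 mule1; rewrite sumEFin a1.
Qed.

Lemma empirical_support (N : nat) (y : 'I_N -> E) : (0 < N)%N ->
  (forall k, Xi (y k)) -> empirical y Xi = 1%E.
Proof.
move=> N0 yXi; have [P PE] := probability_empirical y N0.
rewrite -(probability_setT P) PE /empirical; congr (_ * _)%E.
by apply: eq_bigr => k _; rewrite !diracE !mem_set//; exact: yXi.
Qed.

(* The mixture may put all its weight on the one client whose ball is known to
   contain the target; the other balls only have to be nonempty, and they contain
   their own centers. *)
Lemma global_ambiguity_of_local (n : nat) (N : 'I_n -> nat)
    (y : forall i, 'I_(N i) -> E) (eps : 'I_n -> R) (Q : probability E R)
    (i : 'I_n) :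
  (forall j, 0 < N j)%N -> (forall j k, Xi (y j k)) -> (forall j, 0 <= eps j) ->
  local_ambiguity p Xi (empirical (y i)) (eps i) Q ->
  global_ambiguity p Xi (fun j => empirical (y j)) eps Q.
Proof.
move=> N0 yXi eps0 Qi.
have [e eE] := choice (fun j => probability_empirical (y j) (N0 j)).
exists (fun j => (j == i)%:R), (fun j => if j == i then Q else e j); split.
- split=> [j|]; first by rewrite ler0n.
  by rewrite (bigD1 i)//= eqxx big1 ?addr0// => j /negbTE ->.
- move=> j; have [->//|ji] := eqVneq j i.
  have eyE : empirical (y j) = e j by apply/funext => A; rewrite eE.
  split; last by rewrite eyE; exact: wasserstein_refl.
  apply: distributions_compact => //; first exact: le_trans p_ge1.
  by rewrite eE; exact: empirical_support.
- move=> A mA; rewrite (bigD1 i)//= eqxx mul1e big1 ?adde0// => j /negbTE ->.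
  by rewrite mul0e.
Qed.

End global_ambiguity.

(** Only on this event are the empirical measures known to be supported in [Xi], and so to be usable
    as centers inside their own balls. *)
Lemma ae_sample_support (R : realType) (m : nat) (d : measure_display)
    (Om : measurableType d) (Pr : probability Om R) (Xi : set 'rV[R]_m)
    (n : nat) (N : 'I_n -> nat) (P : 'I_n -> probability (borel_rV R m) R)
    (xi : forall i : 'I_n, 'I_(N i) -> {RV Pr >-> borel_rV R m}) :
  compact Xi -> (forall i, P i Xi = 1%E) -> (forall i, iid_sample (P i) (xi i)) ->
  {ae Pr, forall w, forall i k, Xi (xi i k w)}.
Proof.
move=> Xi_compact P1 xi_iid.
have mXi := compact_measurable_rV Xi_compact.
apply: filter_forall => i; apply: filter_forall => k.
have mX : measurable (xi i k @^-1` Xi).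
  by rewrite -[_ @^-1` _]setTI; exact: measurable_funP.
exists (~` (xi i k @^-1` Xi)); split => //; first exact: measurableC.
apply: etrans (probability_setC Pr mX) _.
have [_ /(_ k _ mXi) XE] := xi_iid i.
by rewrite [X in (_ - X)%E](etrans XE (P1 i)) subee.
Qed.

(** * The two lower bounds on the coverage probability *)

Theorem proposition2 (R : realType) (m : nat) (p c1 c2 : R)
  (p_ge1 : 1 <= p)
  (concentration : concentration_constants m p c1 c2)
  (Xi : set 'rV[R]_m) (Xi_convex : convex_set Xi) (Xi_compact : compact Xi)
  (n : nat) (P : 'I_n -> probability (borel_rV R m) R)
  (P_supp : forall i, distributions p Xi (P i))
  (d : measure_display) (Om : measurableType d) (Pr : probability Om R)
  (N : 'I_n -> nat) (N_gt0 : forall i, (0 < N i)%N)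
  (xi : forall i : 'I_n, 'I_(N i) -> {RV Pr >-> borel_rV R m})
  (xi_iid : forall i, iid_sample (P i) (xi i))
  (xi_indep : independent_samples xi)
  (alpha : 'I_n -> R) (alpha_simplex : simplex alpha)
  (Ptrue : probability (borel_rV R m) R)
  (Ptrue_mixture : is_mixture alpha P Ptrue)
  (delta : R) (delta_ge0 : 0 <= delta)
  (P_close : forall i j, (wasserstein p (P i) (P j) <= delta%:E)%E)
  (beta : 'I_n -> R) (beta_01 : forall i, 0 < beta i < 1)
  (eps : 'I_n -> R)
  (epsE : forall i, eps i = conc_radius p c1 c2 Xi (N i) (beta i))
  (bbeta : 'I_n -> R)
  (bbetaP : forall i,
    shifted_level (conc_radius p c1 c2 Xi (N i)) (eps i) delta (bbeta i)) :
  ((Num.max (\prod_(i < n) (1 - beta i)) (1 - \prod_(i < n) bbeta i))%:E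
   <= inner_prob Pr
        [set w | global_ambiguity p Xi
                   (fun i => empirical (fun k => xi i k w)) eps Ptrue])%E.
Proof.
have [_ _ conc] := concentration.
pose S (e : 'I_n -> R) i : set Om :=
  [set w | (wasserstein p (P i) (empirical (fun k => xi i k w)) <= (e i)%:E)%E].
have mS e i : measurable (S e i) by exact: measurable_wasserstein_le.
have sS e i : g_sigma_preimage (fun k : 'I_(N i) => (xi i k : Om -> borel_rV R m)) (S e i).
  exact: g_sigma_preimage_wasserstein_le.
have concS e i b : 0 < b < 1 -> e i = conc_radius p c1 c2 Xi (N i) b ->
    ((1 - b)%:E <= Pr (S e i))%E.
  by move=> b01 eE; rewrite /S eE; exact: conc.
have P_Xi i : P i Xi = 1%E by have [] := P_supp i.
rewrite maxEge; case: ifPn => _.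
  apply: (@le_trans _ _ (Pr (\bigcap_i S eps i))).
    rewrite (independent_bigcap xi_indep (sS eps)) -prodEFin.
    apply: lee_prod => i; rewrite (concS _ _ _ (beta_01 i) (epsE i)) andbT.
    by have /andP[_ /ltW] := beta_01 i; rewrite lee_fin subr_ge0.
  apply: inner_prob_ge; first by apply: fin_bigcap_measurable.
  (* On this event the true weights and the true client distributions are the witnesses. *)
  move=> w Sw; exists alpha, P; split => // i.
  by split; [exact: P_supp|exact: Sw].
pose C i := S (fun i => eps i - delta) i.
(* If [eps i <= delta] or no level solves the equation, [bbeta i] is 1 and the bound is trivial;
   otherwise it is concentration at level [bbeta i], whose radius is [eps i - delta]. *)
have PrC i : (Pr (~` C i) <= (bbeta i)%:E)%E.
  case: (bbetaP i) => [[_ [b01 bE]]|[_ ->]]; last exact: probability_le1 (measurableC (mS _ _)).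
  have := concS (fun i => eps i - delta) i _ b01 (esym bE).
  rewrite probability_setC//; last exact: mS.
  rewrite -(fineK (fin_num_measure Pr _ (mS (fun i => eps i - delta) i))).
  by rewrite -EFinB !lee_fin; lra.
have mC : measurable (\bigcap_i ~` C i).
  by apply: fin_bigcap_measurable => // i _; apply: measurableC; exact: mS.
(* The event is that some [C i] occurs. The complements of the [C i] still lie in the sigma-algebras
   of the clients' data, so the probability that all fail factorizes. *)
apply: (@le_trans _ _ (Pr (~` \bigcap_i ~` C i))).
  rewrite probability_setC// EFinB leeB// (independent_bigcap xi_indep); last first.
    by move=> i; apply: sigma_algebraC; exact: sS.
  by rewrite -prodEFin; apply: lee_prod => i; rewrite measure_ge0 PrC.
apply: inner_prob_ae_ge; first exact: measurableC.
have := ae_sample_support Xi_compact P_Xi xi_iid; apply: filterS => w wXi.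
move=> /existsNP[i /not_implyP[_ /contrapT Cw]].
have eps0 j : 0 <= eps j by rewrite epsE; exact: conc_radius_ge0.
apply: (@global_ambiguity_of_local _ _ _ p_ge1 _ Xi_compact _ _ _ _ _ i) => //.
split.
  apply: distributions_compact => //; first exact: le_trans p_ge1.
  exact: mixture_support Ptrue_mixture P_Xi.
(* Each [P j] is within [delta] of [P i], itself within [eps i - delta] of the empirical measure, so
   the whole mixture is within [eps i]. *)
apply: (wasserstein_mixture p_ge1 alpha_simplex Ptrue_mixture) => // [A mA|j].
  by have [e <-] := probability_empirical (fun k => xi i k w) (N_gt0 i);
    exact: fin_num_measure.
rewrite -[eps i](subrK delta).
exact: (wasserstein_empirical_triangle p_ge1 (N_gt0 i) (P_close j i) Cw).
Qed.
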